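(* The class of ordered groups which have reductions onto amenable groups contains all ordered groups $(G,P)$ with $G$ amenable, and is closed under hereditary subgroups, finite direct products, and finite free products. Likewise, the class of ordered groups which have strong reductions onto amenable groups contains all ordered groups $(G,P)$ with $G$ amenable, and is closed under hereditary subgroups, finite direct products, and finite free products.
   Context: All groups are discrete. A positive cone in a group $G$ is a submonoid $P$ with $P\cap P^{-1}=\{1\}$; an ordered group $(G,P)$ is a group with a positive cone, with left-invariant partial order $a\le b\iff a^{-1}b\in P$. An order homomorphism $\varphi:(G,P)\to(H,Q)$ is a group homomorphism $G\to H$ with $\varphi(P)\subseteq Q$. It is a reduction if for all $p\in P$ it restricts to a bijection from $[1,p]=\{x:1\le x\le p\}$ onto $[1,\varphi(p)]$, and a strong reduction if $\varphi|_P:P\to Q$ is a bijection. $(G,P)$ has a (strong) reduction to (or onto) an amenable group if there are an amenable group $H$, a positive cone $Q\subset H$ and a (strong) reduction $\varphi:(G,P)\to(H,Q)$. A subsemigroup $Q\subseteq P$ is hereditary in $P$ if $p_1,p_2\in P$ and $p_1p_2\in Q$ imply $p_1,p_2\in Q$. An ordered group $(H,Q)$ is a hereditary subgroup of $(G,P)$ if $H$ is a subgroup of $G$, $Q$ is a subsemigroup of $P\cap H$, and $Q$ is hereditary in $P$. The direct product of $(G_1,P_1)$ and $(G_2,P_2)$ is $(G_1\times G_2,P_1\times P_2)$. The free product is $(G_1*G_2,P_1*P_2)$, where $P_1*P_2$ denotes the submonoid of $G_1*G_2$ generated by the embedded copies of $P_1$ and $P_2$. *)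

(* Defs.v *)
From HB Require Import structures.
From mathcomp Require Import all_boot all_algebra.
From mathcomp Require Import all_classical reals.
Set Implicit Arguments.
Unset Strict Implicit.
Unset Printing Implicit Defensive.
Local Open Scope classical_set_scope.
Local Open Scope group_scope.

(* Between groups, the unital multiplicative maps are exactly the group
   homomorphisms. *)
Notation group_hom := UMagmaMorphism.type.

Section Amenability.
Variables (R : realType) (G : groupType).
Local Open Scope ring_scope.

Definition is_bounded (f : G -> R) : Prop :=
  exists M : R, forall x, `|f x| <= M.

(* A mean on l^oo(G, R); the values of m at unbounded functions are
   irrelevant. *)
Definition is_mean (m : (G -> R) -> R) : Prop :=
  [/\ forall (a : R) (f g : G -> R), is_bounded f -> is_bounded g ->
        m (fun x => a * f x + g x) = a * m f + m g,
      forall f : G -> R, is_bounded f -> (forall x, 0 <= f x) -> 0 <= m f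
    & m (fun=> 1) = 1].

Definition left_invariant (m : (G -> R) -> R) : Prop :=
  forall (g : G) (f : G -> R), is_bounded f ->
    m (fun x => f (g * x)%g) = m f.

Definition amenable : Prop :=
  exists m : (G -> R) -> R, is_mean m /\ left_invariant m.

End Amenability.

Section OrderedGroups.
Variable G : groupType.
Implicit Types (P Q : set G) (x y p : G).

Definition subsemigroup P : Prop := forall x y, P x -> P y -> P (x * y).

Definition submonoid P : Prop := P 1 /\ subsemigroup P.

Definition positive_cone P : Prop :=
  submonoid P /\ P `&` [set x^-1 | x in P] = [set 1].

Definition cone_le P x y : Prop := P (x^-1 * y).

Definition cone_interval P p : set G :=
  [set x | cone_le P 1 x /\ cone_le P x p].

Definition hereditary Q P : Prop :=
  [/\ subsemigroup Q, Q `<=` P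
    & forall p1 p2, P p1 -> P p2 -> Q (p1 * p2) -> Q p1 /\ Q p2].

End OrderedGroups.

Section Reductions.
Variables (G H : groupType) (P : set G) (Q : set H) (phi : group_hom G H).

Definition order_hom : Prop := phi @` P `<=` Q.

Definition reduction : Prop :=
  order_hom /\
  forall p, P p -> set_bij (cone_interval P p) (cone_interval Q (phi p)) phi.

Definition strong_reduction : Prop := order_hom /\ set_bij P Q phi.

End Reductions.

(* Classes of ordered groups are predicates on pairs (G, P) which entail that
   P is a positive cone in G. *)
Definition has_amenable_reduction (R : realType) (G : groupType) (P : set G) :
    Prop :=
  positive_cone P /\
  exists (H : groupType) (Q : set H) (phi : group_hom G H),
    [/\ amenable R H, positive_cone Q & reduction P Q phi].

Definition has_amenable_strong_reduction (R : realType) (G : groupType)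
    (P : set G) : Prop :=
  positive_cone P /\
  exists (H : groupType) (Q : set H) (phi : group_hom G H),
    [/\ amenable R H, positive_cone Q & strong_reduction P Q phi].

(* H is the group structure on the subset S of G, with inclusion val; Q is
   transported to a subset of G along this inclusion. *)
Definition hereditary_subgroup (G : groupType) (P : set G) (S : pred G)
    (H : subGroupType S) (Q : set H) : Prop :=
  positive_cone Q /\ hereditary [set (val q : G) | q in Q] P.

Section DirectProduct.
Variables (I : Type) (G : I -> groupType).

Definition direct_product : Type := forall i, G i.

HB.instance Definition _ := Choice.on direct_product.

Let one : direct_product := fun=> 1.
Let inv (x : direct_product) : direct_product := fun i => (x i)^-1.
Let mul (x y : direct_product) : direct_product := fun i => x i * y i.

Let mulgA : associative mul.
Proof.
by move=> x y z; apply: functional_extensionality_dep => i; exact: mulgA.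
Qed.
Let mul1g : left_id one mul.
Proof.
by move=> x; apply: functional_extensionality_dep => i; exact: mul1g.
Qed.
Let mulg1 : right_id one mul.
Proof.
by move=> x; apply: functional_extensionality_dep => i; exact: mulg1.
Qed.
Let mulVg : left_inverse one inv mul.
Proof.
by move=> x; apply: functional_extensionality_dep => i; exact: mulVg.
Qed.
Let mulgV : right_inverse one inv mul.
Proof.
by move=> x; apply: functional_extensionality_dep => i; exact: mulgV.
Qed.

HB.instance Definition _ :=
  isGroup.Build direct_product mulgA mul1g mulg1 mulVg mulgV.

Definition direct_product_cone (P : forall i, set (G i)) :
    set direct_product := [set x | forall i, P i (x i)].

End DirectProduct.

Section FreeProduct.
Variables (I : Type) (G : I -> groupType).

(* F, with the maps iota i, is the free product (coproduct) of the G i. *)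
Definition is_free_product (F : groupType)
    (iota : forall i, group_hom (G i) F) : Prop :=
  forall (K : groupType) (f : forall i, group_hom (G i) K),
    exists h : group_hom F K,
      (forall i x, h (iota i x) = f i x) /\
      forall h' : group_hom F K,
        (forall i x, h' (iota i x) = f i x) -> h' =1 h.

Definition free_product_cone (F : groupType)
    (iota : forall i, group_hom (G i) F) (P : forall i, set (G i)) : set F :=
  smallest (@submonoid F) (\bigcup_i (iota i @` P i)).

End FreeProduct.

Section FreeProductExists.
Variables (I : Type) (G : I -> groupType).

Let word := seq {i : I & G i}.

Definition word_eval (K : groupType) (f : forall i, group_hom (G i) K)
    (w : word) : K := \prod_(a <- w) f (tag a) (tagged a).

Definition word_inv (w : word) : word :=
  rev [seq Tagged G ((tagged a : G (tag a))^-1) | a : {i : I & G i} <- w].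

(* Words are identified when they have the same value in every group. *)
Definition word_eqv (v w : word) : Prop :=
  forall (K : groupType) (f : forall i, group_hom (G i) K),
    word_eval f v = word_eval f w.

Definition word_class : Type := {c : set word | exists w, c = word_eqv w}.

HB.instance Definition _ := gen_eqMixin word_class.
HB.instance Definition _ := gen_choiceMixin word_class.

Let cls (w : word) : word_class :=
  exist _ (word_eqv w) (ex_intro _ w erefl).
Let rep (c : word_class) : word := sval (cid (svalP c)).

Lemma word_eval_cat K f v w :
  @word_eval K f (v ++ w) = word_eval f v * word_eval f w.
Proof. by rewrite /word_eval big_cat. Qed.

Lemma word_eval_inv K f w : @word_eval K f (word_inv w) = (word_eval f w)^-1.
Proof.
rewrite /word_inv; elim: w => [|a w IHw].
  by rewrite /word_eval !big_nil invg1.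
rewrite /= rev_cons -cats1 word_eval_cat IHw /word_eval big_cons big_nil.
by rewrite /= gmulfV mulg1 big_cons invgM.
Qed.

Let clsP v w : word_eqv v w -> cls v = cls w.
Proof.
move=> vw; apply: eq_exist; apply/seteqP; split=> u uP K f.
  by rewrite -vw uP.
by rewrite vw uP.
Qed.

Let repK : cancel rep cls.
Proof. by case=> c cP; apply: eq_exist; rewrite /rep; case: cid. Qed.

Let clsK w : word_eqv (rep (cls w)) w.
Proof.
rewrite /rep; case: cid => v /= vw K f.
have : word_eqv v w by rewrite -vw.
exact.
Qed.

Let one := cls [::].
Let inv c := cls (word_inv (rep c)).
Let mul c d := cls (rep c ++ rep d).

Let wmulgA : associative mul.
Proof.
move=> x y z; apply: clsP => K f.
by rewrite !word_eval_cat !clsK !word_eval_cat mulgA.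
Qed.
Let wmul1g : left_id one mul.
Proof.
move=> x; rewrite -[RHS]repK; apply: clsP => K f.
by rewrite word_eval_cat clsK /word_eval big_nil mul1g.
Qed.
Let wmulg1 : right_id one mul.
Proof.
move=> x; rewrite -[RHS]repK; apply: clsP => K f.
by rewrite word_eval_cat clsK /word_eval big_nil mulg1.
Qed.
Let wmulVg : left_inverse one inv mul.
Proof.
move=> x; apply: clsP => K f.
by rewrite word_eval_cat clsK word_eval_inv mulVg /word_eval big_nil.
Qed.
Let wmulgV : right_inverse one inv mul.
Proof.
move=> x; apply: clsP => K f.
by rewrite word_eval_cat clsK word_eval_inv mulgV /word_eval big_nil.
Qed.

HB.instance Definition _ :=
  isGroup.Build word_class wmulgA wmul1g wmulg1 wmulVg wmulgV.

Definition word_inj (i : I) (x : G i) : word_class := cls [:: Tagged G x].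

Let word_injM i : {morph @word_inj i : x y / x / y}.
Proof.
move=> x y; apply: clsP => K f.
rewrite word_eval_cat !clsK word_eval_inv clsK /word_eval !big_cons !big_nil /=.
by rewrite !mulg1 gmulfF.
Qed.

HB.instance Definition _ i :=
  isGroupMorphism.Build (G i) word_class (@word_inj i) (@word_injM i).

Definition word_lift (K : groupType) (f : forall i, group_hom (G i) K)
    (c : word_class) : K := word_eval f (rep c).

Let word_liftM K f : {morph @word_lift K f : x y / x / y}.
Proof.
by move=> x y; rewrite /word_lift clsK word_eval_cat clsK word_eval_inv.
Qed.

HB.instance Definition _ K f :=
  isGroupMorphism.Build word_class K (@word_lift K f) (@word_liftM K f).

Theorem free_product_exists :
  exists (F : groupType) (iota : forall i, group_hom (G i) F),
    is_free_product iota.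
Proof.
exists word_class, (fun i => @word_inj i) => K f.
exists (word_lift f : group_hom _ _); split=> [i x|h hf c] /=.
  by rewrite /word_lift clsK /word_eval big_cons big_nil /= mulg1.
rewrite -[c]repK /word_lift clsK; elim: (rep c) => [|[i x] w IHw].
  by rewrite /word_eval big_nil; exact: gmulf1.
rewrite /word_eval big_cons -/(word_eval f w) -IHw /= -hf -gmulfM /=.
congr (h _); apply: clsP => L g.
by rewrite word_eval_cat !clsK /word_eval !big_cons big_nil /= mulg1.
Qed.

End FreeProductExists.

Section ClosureProperties.
Variable C : forall G : groupType, set G -> Prop.

Definition closed_hereditary_subgroups : Prop :=
  forall (G : groupType) (P : set G) (S : pred G) (H : subGroupType S)
    (Q : set H), C P -> hereditary_subgroup P Q -> C Q.

Definition closed_finite_direct_products : Prop :=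
  forall (I : finType) (G : I -> groupType) (P : forall i, set (G i)),
    (forall i, C (P i)) -> C (direct_product_cone P).

Definition closed_finite_free_products : Prop :=
  forall (I : finType) (G : I -> groupType) (P : forall i, set (G i))
    (F : groupType) (iota : forall i, group_hom (G i) F),
    is_free_product iota -> (forall i, C (P i)) ->
    C (free_product_cone iota P).

End ClosureProperties.

(* Main.v *)
(* If (G_i, P_i) reduces to (H_i, Q_i) with H_i amenable, put H = prod_i H_i
   and let L be the lamplighter group (I x H -> Z/2) x| H, which is amenable.
   Map H_i into L by conjugating its copy in H by a single lamp at (i, 1).
   A product h_1 ... h_n of nontrivial positive letters, consecutive ones in
   different factors, then lights the lamps (i_k, x_(k-1)) and (i_k, x_k),
   where x_k = h_1 ... h_k in H; these lamps are distinct because the x_k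
   strictly increase.  The only lit lamp at 1 gives i_1, and the first
   increment x_1 is the least i_1-th coordinate among the other lit lamps, so
   the word can be read off from its image in L.  Hence reduced words in the
   generators of the free product cone are determined by their image, first
   letters of factorisations of an element are bounded by its first letter,
   and reductions of the factors assemble letter by letter into a reduction of
   the free product to L. *)
Require Import Defs.
From HB Require Import structures.
From mathcomp Require Import all_boot all_order all_algebra.
From mathcomp Require Import all_classical reals topology normedtype.
From mathcomp Require Import lra.
Set Implicit Arguments.
Unset Strict Implicit.
Unset Printing Implicit Defensive.
Import Order.TTheory GRing.Theory Num.Theory.
Import numFieldNormedType.Exports.
Local Open Scope classical_set_scope.
Local Open Scope ring_scope.

(** * Amenability *)

Section Bounded.
Variables (R : realType) (G : groupType).
Implicit Types (f g : G -> R) (m : (G -> R) -> R).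

Lemma is_bounded_cst (c : R) : is_bounded (G := G) (fun=> c : R).
Proof. by exists `|c|. Qed.

Lemma mean_cst m (c : R) : is_mean m -> m (fun=> c) = c.
Proof.
move=> [lin _ m1]; have b1 := is_bounded_cst 1; have b0 := is_bounded_cst 0.
have m0 : m (fun=> 0) = 0.
  have := lin 1 _ _ b0 b0; rewrite (_ : (fun _ => _) = fun=> 0); first by lra.
  by apply/funext => x; rewrite mulr0 addr0.
have := lin c _ _ b1 b0; rewrite (_ : (fun _ => _) = fun=> c).
  by rewrite m0 m1; lra.
by apply/funext => x; rewrite mulr1 addr0.
Qed.

(** Both [M - f] and [M + f] are nonnegative, and a mean is positive, linear and fixes constants. *)
Lemma mean_norm_le m f (M : R) : is_mean m -> (forall x, `|f x| <= M) ->
  `|m f| <= M.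
Proof.
move=> mm fM; have [lin pos m1] := mm.
have bf : is_bounded f by exists M.
have bM := is_bounded_cst M.
have hi : 0 <= m (fun x => -1 * f x + M).
  apply: pos => [|x]; last by have := fM x; rewrite ler_norml => /andP[]; lra.
  exists (M + `|M|) => x.
  by rewrite (le_trans (ler_normD _ _))// mulN1r normrN lerD.
have lo : 0 <= m (fun x => 1 * f x + M).
  apply: pos => [|x]; last by have := fM x; rewrite ler_norml => /andP[]; lra.
  by exists (M + `|M|) => x; rewrite (le_trans (ler_normD _ _))// mul1r lerD.
move: hi lo; rewrite !lin// !mean_cst// ler_norml => hi lo.
by apply/andP; split; lra.
Qed.

End Bounded.

(** If a filter [D] extends the image filter and [A] is in [D], then [F] contains the preimage of
    [A] or of its complement; the latter would put two disjoint sets in [D]. *)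
Lemma ultra_map (S T : Type) (F : set_system S) (f : S -> T) :
  UltraFilter F -> UltraFilter (f @ F).
Proof.
move=> FU; split=> [|D DF FD]; first exact: fmap_proper_filter.
apply/seteqP; split=> // A DA.
have [//|nFA] := in_ultra_setVsetC (f @^-1` A) FU.
have /filter_ex[x []//] : D (A `&` ~` A).
by apply: filterI => //; apply: FD; rewrite /= preimage_setC.
Qed.

Lemma ultra_bounded_cvg (R : realType) (T : Type) (F : set_system T)
    (u : T -> R) (M : R) : UltraFilter F -> (forall x, `|u x| <= M) ->
  cvg (u @ F).
Proof.
move=> FU uM; have : compact `[- M, M]%classic := @segment_compact R (- M) M.
rewrite compact_ultra => /(_ _ (ultra_map u FU))[|l [_ lU]].
  by apply: (@filterE _ F) => s /=; rewrite in_itv/= -ler_norml.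
by apply/cvg_ex; exists l.
Qed.

(** * Amenability of groups of exponent two *)

Section ExponentTwo.
Variables (R : realType) (G : groupType).
Hypothesis exp2 : forall x : G, (x * x = 1)%g.

(* The average of f over the products of the 2 ^ (size s) sublists of s; these
   averages play the role of a Folner net. *)
Fixpoint list_average (s : seq G) (f : G -> R) : R :=
  if s is a :: s' then
    (list_average s' f + list_average s' (fun x => f (a * x)%g)) / 2
  else f 1%g.

Let mulgC (x y : G) : (x * y = y * x)%g.
Proof.
have V (z : G) : (z^-1 = z)%g by exact: mulg1_eq.
by rewrite -[LHS]V invgM !V.
Qed.

Lemma list_average_lin s (a : R) f g :
  list_average s (fun x => a * f x + g x) =
  a * list_average s f + list_average s g.
Proof.
elim: s f g => [//|b s IHs] f g /=.
by rewrite IHs (IHs (fun x => f (b * x)%g)); lra.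
Qed.

Lemma list_average_ge0 s f : (forall x, 0 <= f x) -> 0 <= list_average s f.
Proof.
elim: s f => [|b s IHs] f f0 //=.
by apply: divr_ge0 => //; apply: addr_ge0; apply: IHs => x.
Qed.

Lemma list_average1 s : list_average s (fun=> 1) = 1.
Proof. by elim: s => //= b s ->; lra. Qed.

Lemma list_average_norm_le s f M : (forall x, `|f x| <= M) ->
  `|list_average s f| <= M.
Proof.
elim: s f => [|b s IHs] f fM //=.
have := IHs _ fM; have := IHs (fun x => f (b * x)%g) (fun x => fM _).
by rewrite !ler_norml => /andP[? ?] /andP[? ?]; apply/andP; split; lra.
Qed.

(** Translation by the head of the list swaps the two halves of the average, since [a * a = 1].
    Translation by a later element commutes past the head, as exponent two forces commutativity. *)
Lemma list_average_invariant s a f : a \in s ->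
  list_average s (fun x => f (a * x)%g) = list_average s f.
Proof.
elim: s f => //= b s IHs f; rewrite inE => /predU1P[->|sa].
  rewrite addrC; congr ((list_average _ _ + _) / _).
  by apply/funext => x; rewrite mulgA exp2 mul1g.
rewrite IHs// -[in RHS](IHs (fun x => f (b * x)%g))//.
congr ((_ + list_average _ _) / _).
by apply/funext => x; rewrite !mulgA (mulgC a).
Qed.

Lemma exponent_two_amenable : amenable R G.
Proof.
(* The sets [B s] generate a proper filter, refined by an ultrafilter. Along it a fixed [a]
   eventually lies in the list, and from then on the averages are exactly invariant under [a]. *)
pose B (s : seq G) := [set t : seq G | {subset s <= t}].
have FB : ProperFilter (filter_from setT B).
  apply: filter_from_proper => [|s _]; last by exists s.
  apply: filter_fromT_filter; first by exists [::].
  move=> s t; exists (s ++ t) => u stu.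
  by split=> x xs; apply: stu; rewrite mem_cat xs ?orbT.
have [U [UU BU]] := ultraFilterLemma FB.
have UF : ProperFilter U := ultra_proper.
have cv (f : G -> R) : is_bounded f -> cvg (list_average s f @[s --> U]).
  move=> [M fM]; apply: (ultra_bounded_cvg (M := M)) => s.
  exact: list_average_norm_le.
exists (fun f => lim (list_average s f @[s --> U])); split; first split.
- move=> a f g bf bg; apply: cvg_lim => //.
  rewrite (_ : (fun s => _) = fun s => a * list_average s f + list_average s g).
    by apply: cvgD; [apply: cvgMl_tmp; exact: cv | exact: cv].
  by apply/funext => s; exact: list_average_lin.
- move=> f bf f0; apply: limr_ge; first exact: cv.
  by apply: nearW => s; exact: list_average_ge0.
- rewrite (_ : (fun s => _) = fun=> 1); first exact: lim_cst.
  by apply/funext => s; exact: list_average1.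
- move=> a f bf; apply: cvg_lim => //; apply: cvg_trans (cv f bf).
  apply: near_eq_cvg; apply: BU; exists [:: a] => // s /= as_.
  by rewrite list_average_invariant// as_ ?mem_head.
Qed.

End ExponentTwo.

(** * Finite direct products of amenable groups *)

Section DirectProduct.
Variables (I : Type) (G : I -> groupType).
Implicit Types x y : direct_product G.
Local Open Scope group_scope.

Lemma direct_productM x y j : (x * y) j = x j * y j.
Proof. by []. Qed.

Lemma direct_productV x j : x^-1 j = (x j)^-1.
Proof. by []. Qed.

End DirectProduct.

Section ProductAmenable.
Variables (R : realType) (I : finType) (G : I -> groupType).
Variable m : forall i, (G i -> R) -> R.
Arguments m : clear implicits.
Hypothesis m_mean : forall i, is_mean (m i).
Hypothesis m_inv : forall i, left_invariant (m i).
Let D := direct_product G.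
Implicit Types (f g : D -> R) (s : seq I) (x : D).

(** Integrates out coordinate [i], as [dfwith x i y] replaces the [i]-th coordinate of [x] by [y].
    Folding over all indices imitates a product measure. *)
Definition average_at i f : D -> R := fun x => m i (fun y => f (dfwith x i y)).

Definition averages s f : D -> R := foldr average_at f s.

Definition independent i f := forall x (y : G i), f (dfwith x i y) = f x.

Lemma averages_norm_le s f M : (forall x, `|f x| <= M) ->
  forall x, `|averages s f x| <= M.
Proof. by move=> fM; elim: s => //= i s IHs x; exact: mean_norm_le. Qed.

Lemma is_bounded_averages s f : is_bounded f -> is_bounded (averages s f).
Proof. by move=> [M fM]; exists M; exact: averages_norm_le. Qed.

Let is_bounded_slice i f x : is_bounded f ->
  is_bounded (fun y : G i => f (dfwith x i y)).
Proof. by move=> [M fM]; exists M => y. Qed.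

Lemma averages_lin s a f g : is_bounded f -> is_bounded g ->
  averages s (fun x => a * f x + g x) =
  fun x => a * averages s f x + averages s g x.
Proof.
move=> bf bg; elim: s => //= i s ->; apply/funext => x.
have [lin _ _] := m_mean i.
by apply: lin; apply: is_bounded_slice; exact: is_bounded_averages.
Qed.

Lemma averages_ge0 s f : is_bounded f -> (forall x, 0 <= f x) ->
  forall x, 0 <= averages s f x.
Proof.
move=> bf f0; elim: s => //= i s IHs x; have [_ pos _] := m_mean i.
by apply: pos => //; apply: is_bounded_slice; exact: is_bounded_averages.
Qed.

Lemma averages1 s : averages s (fun=> 1) = fun=> 1.
Proof. by elim: s => //= i s ->; apply/funext => x; case: (m_mean i). Qed.

(** Invariance of [m i] absorbs the translation of the coordinate being averaged; the other
    coordinates translate along with [x]. *)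
Lemma averages_translate s (g : D) f : is_bounded f ->
  averages s (fun x => f (g * x)%g) = fun x => averages s f (g * x)%g.
Proof.
move=> bf; elim: s => //= i s ->; apply/funext => x.
rewrite /average_at -[RHS](m_inv (g i)); last first.
  by apply: is_bounded_slice; exact: is_bounded_averages.
congr (m i _); apply/funext => y; congr (averages s f _).
apply: functional_extensionality_dep => j.
have [<-|ij] := eqVneq i j; last first.
  by rewrite direct_productM !dfwithout.
by rewrite direct_productM !dfwithin.
Qed.

(** Averaging at [i] overwrites coordinate [i]; averaging at another index keeps the independence,
    because updates of distinct coordinates commute. *)
Lemma averages_independent s f i : i \in s -> independent i (averages s f).
Proof.
elim: s => //= j s IHs; rewrite inE => ijs x y; rewrite /average_at.
have [ij|ij] := eqVneq i j.
  case: j / ij ijs => _; congr (m i _).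
  apply/funext => z; congr (averages s f _).
  apply: functional_extensionality_dep => j.
  have [<-|ij] := eqVneq i j; first by rewrite !dfwithin.
  by rewrite !dfwithout.
move: ijs; rewrite (negbTE ij)/= => /IHs {}IHs.
congr (m j _); apply/funext => z.
rewrite -[RHS](IHs _ y); congr (averages s f _).
apply: functional_extensionality_dep => k.
have [jk|jk] := eqVneq j k; last first.
  rewrite [LHS]dfwithout//; have [ik|ik] := eqVneq i k.
    by case: k / ik jk => _; rewrite !dfwithin.
  by rewrite !dfwithout.
by case: k / jk; rewrite dfwithin dfwithout// dfwithin.
Qed.

(** The coordinates are reset to [1] one at a time along an enumeration of the finite type [I]. *)
Lemma independent_const f x : (forall i, independent i f) -> f x = f 1%g.
Proof.
move=> indf; pose trunc s : D := fun j => if j \in s then 1%g else x j.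
have fE s : f (trunc s) = f x.
  elim: s => [|i s <-]; first by congr f.
  rewrite -(indf i (trunc s) 1%g); congr f.
  apply: functional_extensionality_dep => j; rewrite /trunc inE.
  have [ji|ji] := eqVneq j i; first by case: i / ji; rewrite dfwithin.
  by rewrite dfwithout// eq_sym.
rewrite -(fE (enum I)); congr f; apply: functional_extensionality_dep => j.
by rewrite /trunc mem_enum.
Qed.

End ProductAmenable.

Lemma direct_product_amenable (R : realType) (I : finType)
    (G : I -> groupType) :
  (forall i, amenable R (G i)) -> amenable R (direct_product G).
Proof.
move=> amG; pose m i := sval (cid (amG i)).
have m_mean i : is_mean (m i) by rewrite /m; case: cid => ? [].
have m_inv i : left_invariant (m i) by rewrite /m; case: cid => ? [].
(* Averaged over every coordinate, [f] becomes constant, so the evaluation point is immaterial; a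
   translation moves only that point. *)
exists (fun f => averages m (enum I) f 1%g); split; first split.
- by move=> a f g bf bg; rewrite averages_lin.
- by move=> f bf f0; exact: averages_ge0.
- by rewrite averages1.
- move=> g f bf; rewrite averages_translate//; apply: independent_const => i.
  by apply: averages_independent; rewrite mem_enum.
Qed.

(** * Lamplighter groups *)

Section Lamps.
Local Open Scope group_scope.
Variables (J H : Type).

(** All configurations are allowed, not only finitely supported ones; amenability will come from
    exponent two. *)
Definition lamps : Type := J -> H -> bool.

HB.instance Definition _ := Choice.on lamps.

Let one : lamps := fun _ _ => false.
Let inv (a : lamps) : lamps := a.
Let mul (a b : lamps) : lamps := fun j x => a j x (+) b j x.

Let mulA : associative mul.
Proof. by move=> a b c; apply/funext => j; apply/funext => x; exact: addbA. Qed.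
Let mul1 : left_id one mul.
Proof. by move=> a; apply/funext => j; apply/funext => x. Qed.
Let mulr1 : right_id one mul.
Proof. by move=> a; apply/funext => j; apply/funext => x; exact: addbF. Qed.
Let mulV : left_inverse one inv mul.
Proof. by move=> a; apply/funext => j; apply/funext => x; exact: addbb. Qed.

HB.instance Definition _ := isGroup.Build lamps mulA mul1 mulr1 mulV mulV.

Lemma lampsM (a b : lamps) j x : (a * b) j x = a j x (+) b j x.
Proof. by []. Qed.

Lemma lamps_exp2 (a : lamps) : a * a = 1.
Proof. exact: mulV. Qed.

End Lamps.

Section Lamplighter.
Local Open Scope group_scope.
Variables (J : Type) (H : groupType).

Definition lamplighter : Type := (lamps J H * H)%type.

HB.instance Definition _ := Choice.on lamplighter.

Definition shift (h : H) (a : lamps J H) : lamps J H :=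
  fun j x => a j (h^-1 * x).

Let one : lamplighter := (1, 1).
Let inv (u : lamplighter) : lamplighter := (shift u.2^-1 u.1, u.2^-1).
Let mul (u v : lamplighter) : lamplighter := (u.1 * shift u.2 v.1, u.2 * v.2).

Lemma shiftM h k a : shift (h * k) a = shift h (shift k a).
Proof. by apply/funext => j; apply/funext => x; rewrite /shift invgM mulgA. Qed.

Lemma shift1 a : shift 1 a = a.
Proof. by apply/funext => j; apply/funext => x; rewrite /shift invg1 mul1g. Qed.

Lemma shift_mul h a b : shift h (a * b) = shift h a * shift h b.
Proof. by []. Qed.

Let mulA : associative mul.
Proof. by move=> u v w; rewrite /mul/= shift_mul shiftM !mulgA. Qed.
Let mul1 : left_id one mul.
Proof. by case=> a h; rewrite /mul/= shift1 !mul1g. Qed.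
Let mulr1 : right_id one mul.
Proof. by case=> a h; rewrite /mul/= !mulg1. Qed.
Let mulV : left_inverse one inv mul.
Proof. by case=> a h; rewrite /mul/= -shift_mul lamps_exp2 mulVg. Qed.
Let mulrV : right_inverse one inv mul.
Proof. by case=> a h; rewrite /mul/= -shiftM mulgV shift1 lamps_exp2. Qed.

HB.instance Definition _ :=
  isGroup.Build lamplighter mulA mul1 mulr1 mulV mulrV.

Lemma lamplighterM (u v : lamplighter) :
  u * v = (u.1 * shift u.2 v.1, u.2 * v.2).
Proof. by []. Qed.

Lemma lamplighter_amenable (R : realType) :
  amenable R H -> amenable R lamplighter.
Proof.
move=> [mH [meanH invH]].
have [mA [meanA invA]] := exponent_two_amenable R (@lamps_exp2 J H).
have [linH posH H1] := meanH; have [linA posA A1] := meanA.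
(* The fibre over [h] is parametrised by [(1, h) * (a, 1)]. Left multiplication by [(b, k)] then
   sends [h] to [k * h] and [a] to [shift (k * h)^-1 b * a], so the two invariances apply in
   turn. *)
pose F (f : lamplighter -> R) h := mA (fun a => f (shift h a, h)).
have slice f h : is_bounded f -> is_bounded (fun a => f (shift h a, h) : R).
  by move=> [M fM]; exists M => a.
have bF f : is_bounded f -> is_bounded (F f).
  by move=> [M fM]; exists M => h; exact: mean_norm_le.
exists (fun f => mH (F f)); split; first split.
- move=> a f g bf bg; rewrite -linH; try exact: bF.
  by congr mH; apply/funext => h; apply: linA; exact: slice.
- move=> f bf f0; apply: posH => [|h]; first exact: bF.
  by apply: posA => //; exact: slice.
- by rewrite -[RHS]H1; congr mH; apply/funext => h.
- move=> [b k] f bf; rewrite -[RHS](invH k); last exact: bF.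
  congr mH; apply/funext => h.
  rewrite /F -[RHS](invA (shift (k * h)^-1 b)); last exact: slice.
  congr mA; apply/funext => a; congr f; rewrite lamplighterM/=; congr pair.
  by rewrite shift_mul -!shiftM mulgV shift1.
Qed.

End Lamplighter.

(** * Positive cones and reductions *)

Local Open Scope group_scope.

Section Cones.
Variables (G : groupType) (P : set G).
Hypothesis coneP : positive_cone P.

Lemma cone1 : P 1. Proof. by case: coneP => -[]. Qed.

Lemma coneM x y : P x -> P y -> P (x * y).
Proof. by case: coneP => -[] _ + _; exact. Qed.

Lemma cone_eq1 x y : P x -> P y -> x * y = 1 -> x = 1.
Proof.
move=> Px Py xy; have : (P `&` [set z^-1 | z in P]) x.
  by split=> //; exists y => //; rewrite -(mulg1_eq xy) invgK.
by case: coneP => _ ->.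
Qed.

Lemma cone_le_anti x y : cone_le P x y -> cone_le P y x -> x = y.
Proof.
move=> xy yx; have /mulg1_eq : x^-1 * y = 1.
  by apply: (cone_eq1 xy yx); rewrite mulgA mulgK mulVg.
by rewrite invgK.
Qed.

Lemma cone_intervalE p x : cone_interval P p x <-> P x /\ P (x^-1 * p).
Proof. by rewrite /cone_interval /cone_le /= invg1 mul1g. Qed.

End Cones.

Lemma positive_coneP (G : groupType) (P : set G) : submonoid P ->
  (forall x y, P x -> P y -> x * y = 1 -> x = 1) -> positive_cone P.
Proof.
move=> PM P1; split=> //; apply/seteqP; split=> [x [Px [y Py yx]]|x ->].
  by apply: (P1 x y) => //; rewrite -yx mulVg.
by split; [case: PM | exists 1; [case: PM | exact: invg1]].
Qed.

Section Reductions.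
Variables (G H : groupType) (P : set G) (Q : set H) (phi : group_hom G H).

(** An order homomorphism always maps intervals into intervals, so only lifting and injectivity
    remain. *)
Lemma reductionP : order_hom P Q phi ->
  (forall p a, P p -> Q a -> Q (a^-1 * phi p) ->
    exists x, [/\ P x, P (x^-1 * p) & phi x = a]) ->
  (forall p x y, P p -> P x -> P (x^-1 * p) -> P y -> P (y^-1 * p) ->
    phi x = phi y -> x = y) ->
  reduction P Q phi.
Proof.
move=> homP lift inj; split=> // p Pp; split.
- move=> x /cone_intervalE[Px Pxp]; apply/cone_intervalE; split.
    by apply: homP; exists x.
  by rewrite -gmulfV -gmulfM; apply: homP; exists (x^-1 * p).
- move=> x y; rewrite !inE => /cone_intervalE[Px Pxp] /cone_intervalE[Py Pyp].
  exact: (inj p).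
- move=> a /cone_intervalE[Qa Qap]; have [x [Px Pxp <-]] := lift p a Pp Qa Qap.
  by exists x => //; apply/cone_intervalE.
Qed.

(** To lift [a] below [phi p], both [a] and [a^-1 * phi p] are lifted to [P]; the product of the
    lifts has the image of [p], hence equals [p]. *)
Lemma strong_reductionW : positive_cone P -> strong_reduction P Q phi ->
  reduction P Q phi.
Proof.
move=> coneP [homP [_ inj surj]].
have injP x y : P x -> P y -> phi x = phi y -> x = y.
  by move=> Px Py; apply: inj; rewrite inE.
apply: reductionP => //
    [p a Pp /surj[x Px <-] /surj[y Py yE]|p x y _ Px _ Py _].
  suff <- : x * y = p by exists x; rewrite mulKg.
  apply: injP => //; first exact: coneM.
  by rewrite gmulfM yE mulVKg.
exact: injP.
Qed.

Hypothesis redP : reduction P Q phi.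

Lemma reduction_lift p a : P p -> Q a -> Q (a^-1 * phi p) ->
  exists x, [/\ P x, P (x^-1 * p) & phi x = a].
Proof.
move=> Pp Qa Qap; have [_ /(_ p Pp)[_ _ surj]] := redP.
have [|x /cone_intervalE[Px Pxp] <-] := surj a; last by exists x.
exact/cone_intervalE.
Qed.

Lemma reduction_inj p x y : P p -> P x -> P (x^-1 * p) -> P y ->
  P (y^-1 * p) -> phi x = phi y -> x = y.
Proof.
move=> Pp Px Pxp Py Pyp; have [_ /(_ p Pp)[_ inj _]] := redP.
by apply: inj; rewrite inE; apply/cone_intervalE.
Qed.

Hypothesis coneP : positive_cone P.

Lemma reduction_ker x : P x -> phi x = 1 -> x = 1.
Proof.
move=> Px x1.
apply: (reduction_inj (p := x)); rewrite // ?mulVg ?invg1 ?mul1g //.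
- exact: cone1.
- exact: cone1.
- by rewrite gmulf1.
Qed.

(** On an interval the order is reflected too: [phi x] lifts to some [b] in [[1, y]], and [x], [b]
    both lie in [[1, p]], so they agree. *)
Lemma reduction_le p x y : P p -> P x -> P (x^-1 * p) -> P y ->
  P (y^-1 * p) -> Q ((phi x)^-1 * phi y) -> P (x^-1 * y).
Proof.
move=> Pp Px Pxp Py Pyp xy.
have Qx : Q (phi x) by case: redP => + _; apply; exists x.
have [b [Pb Pby bx]] := reduction_lift Py Qx xy.
suff -> : x = b by [].
apply: (reduction_inj Pp) => //.
by rewrite -(mulVKg y p) mulgA; exact: coneM.
Qed.

End Reductions.

(** * Reduced words *)

Section Words.
Variables (I : eqType) (G : I -> groupType) (P : forall i, set (G i)).
Arguments P : clear implicits.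
Hypothesis coneP : forall i, positive_cone (P i).
Let word := seq {i : I & G i}.

Fixpoint reduced (w : word) : Prop :=
  if w is a :: w' then
    [/\ P (tag a) (tagged a), tagged a <> 1,
        ohead [seq tag b | b <- w'] <> Some (tag a) & reduced w']
  else True.

Section Eval.
Variables (K : groupType) (f : forall i, group_hom (G i) K).

Lemma word_eval_nil : word_eval f [::] = 1.
Proof. by rewrite /word_eval big_nil. Qed.

Lemma word_eval_cons a w :
  word_eval f (a :: w) = f (tag a) (tagged a) * word_eval f w.
Proof. by rewrite /word_eval big_cons. Qed.

Lemma free_product_cone1 : free_product_cone f P 1.
Proof. by move=> M [[M1 _] _]. Qed.

Lemma free_product_coneM x y :
  free_product_cone f P x -> free_product_cone f P y ->
  free_product_cone f P (x * y).
Proof.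
by move=> Px Py M MM; case: (MM) => -[_ +] _; apply; [exact: Px | exact: Py].
Qed.

Lemma free_product_cone_inj i x : P i x -> free_product_cone f P (f i x).
Proof. by move=> Px M [_ +]; apply; exists i => //; exists x. Qed.

Lemma free_product_cone_eval w : reduced w ->
  free_product_cone f P (word_eval f w).
Proof.
elim: w => [|a w IHw] /= => [_|[Pa _ _ /IHw Pw]].
  by rewrite word_eval_nil; exact: free_product_cone1.
rewrite word_eval_cons; apply: free_product_coneM => //.
exact: free_product_cone_inj.
Qed.

(** A letter is either prepended or merged with a first letter from the same factor. Merging never
    cancels, by positivity, and the new first letter is at least [x]. *)
Lemma reduced_cons i (x : G i) w : P i x -> x <> 1 -> reduced w ->
  exists c w', [/\ reduced (Tagged G (c : G i) :: w'), P i (x^-1 * c) &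
    f i x * word_eval f w = word_eval f (Tagged G c :: w')].
Proof.
move=> Px x1; case: w => [|[j y] w] rw.
  exists x, [::]; split; first by [].
  - by rewrite mulVg; exact: cone1.
  - by rewrite word_eval_cons.
have [ij|ij] := eqVneq j i; last first.
  exists x, (Tagged G y :: w); rewrite !word_eval_cons mulVg; split=> //.
    by split=> //= -[]; exact/eqP.
  exact: cone1 (coneP i).
case: rw => /= Py y1 hw rw; move: Py y1 hw; case: i / ij x Px x1 => x Px x1.
move=> Py y1 hw; exists (x * y), w; split.
- split=> //=; first exact: (coneM (coneP _)).
  by move=> xy; apply: x1; exact: (cone_eq1 (coneP _) Px Py).
- by rewrite mulKg.
- by rewrite !word_eval_cons /= gmulfM mulgA.
Qed.

Lemma free_product_coneP x :
  free_product_cone f P x -> exists2 w, reduced w & word_eval f w = x.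
Proof.
apply: (smallest_sub (X := [set y | exists2 w, reduced w & word_eval f w = y])).
  split=> [|_ _ [v rv <-] [w rw <-]].
    by exists [::] => //; exact: word_eval_nil.
  elim: v rv => [|[i y] v IHv] /= => [_|[Py y1 _ /IHv [u ru uE]]].
    by exists w; rewrite ?word_eval_nil ?mul1g.
  have [c [u' [ru' _ u'E]]] := reduced_cons Py y1 ru.
  by exists (Tagged G c :: u') => //; rewrite -u'E uE word_eval_cons /= mulgA.
move=> _ [i _ [y Py <-]].
have [->|/eqP y1] := eqVneq y 1.
  by exists [::]; rewrite // word_eval_nil gmulf1.
by exists [:: Tagged G y]; rewrite // word_eval_cons word_eval_nil mulg1.
Qed.

Definition unique_reduced : Prop :=
  forall v w, reduced v -> reduced w -> word_eval f v = word_eval f w -> v = w.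

Hypothesis uniq : unique_reduced.

(** Writing [m] as a reduced word and absorbing [x] gives a reduced word for the product whose first
    letter is at least [x]; by uniqueness it is [w]. *)
Lemma first_letter i (x : G i) m w :
  P i x -> x <> 1 -> free_product_cone f P m -> reduced w ->
  f i x * m = word_eval f w ->
  exists (c : G i) w', w = Tagged G c :: w' /\ P i (x^-1 * c).
Proof.
move=> Px x1 /free_product_coneP[v rv <-] rw wE.
have [c [v' [rv' xc v'E]]] := reduced_cons Px x1 rv.
by exists c, v'; split=> //; apply: uniq; rewrite // -wE.
Qed.

(** If [x * y = 1] with [x] given by a nonempty reduced word, [first_letter] would give the empty
    word a first letter. *)
Lemma free_product_cone_positive : positive_cone (free_product_cone f P).
Proof.
apply: positive_coneP.
  split=> [|x y]; [exact: free_product_cone1 | exact: free_product_coneM].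
move=> _ y /free_product_coneP[[|[i x] w] rw <-] Py xy.
  exact: word_eval_nil.
case: rw => /= Px x1 _ /free_product_cone_eval Pw.
case: (@first_letter i x (word_eval f w * y) [::]) => //.
- exact: free_product_coneM.
- by rewrite word_eval_nil -xy word_eval_cons /= mulgA.
by move=> c [w' []].
Qed.

End Eval.

Lemma unique_reduced_comp (K L : groupType) (f : forall i, group_hom (G i) K)
    (g : forall i, group_hom (G i) L) (h : group_hom K L) :
  (forall i x, h (f i x) = g i x) -> unique_reduced g -> unique_reduced f.
Proof.
move=> hf ug v w rv rw vw.
have hE u : h (word_eval f u) = word_eval g u.
  by rewrite /word_eval gmulf_prod; apply: eq_bigr => a _; exact: hf.
by apply: ug; rewrite // -!hE vw.
Qed.

End Words.

(** * Reductions between generated cones *)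

Section GeneratedReduction.
Variables (I : eqType) (G H : I -> groupType).
Variables (P : forall i, set (G i)) (Q : forall i, set (H i)).
Arguments P : clear implicits.
Arguments Q : clear implicits.
Hypothesis coneP : forall i, positive_cone (P i).
Hypothesis coneQ : forall i, positive_cone (Q i).
Variable phi : forall i, group_hom (G i) (H i).
Variables (K L : groupType).
Variables (f : forall i, group_hom (G i) K) (g : forall i, group_hom (H i) L).
Variable psi : group_hom K L.
Hypothesis psi_f : forall i x, psi (f i x) = g i (phi i x).
Hypothesis uniq_f : unique_reduced P f.
Hypothesis uniq_g : unique_reduced Q g.

Let map_word (w : seq {i : I & G i}) : seq {i : I & H i} :=
  [seq Tagged H (phi (tag a) (tagged a)) | a <- w].

Let psi_eval w : psi (word_eval f w) = word_eval g (map_word w).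
Proof.
by rewrite /word_eval gmulf_prod big_map; apply: eq_bigr => a _; exact: psi_f.
Qed.

Hypothesis redP : forall i, reduction (P i) (Q i) (phi i).

Let homP i : order_hom (P i) (Q i) (phi i). Proof. by case: (redP i). Qed.

Let kerP i x : P i x -> phi i x = 1 -> x = 1.
Proof. exact: reduction_ker. Qed.

Lemma generated_order_hom :
  order_hom (free_product_cone f P) (free_product_cone g Q) psi.
Proof.
move=> _ [x /(free_product_coneP coneP)[w rw <-] <-].
rewrite psi_eval; elim: w rw => [|a w IHw] /= => [_|[Pa _ _ /IHw Qw]].
  by rewrite word_eval_nil; exact: free_product_cone1.
rewrite word_eval_cons; apply: free_product_coneM => //.
by apply: free_product_cone_inj; apply: homP; exists (tagged a).
Qed.

(** Letters stay nontrivial because a reduction has trivial kernel on the positive cone. *)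
Let reduced_map w : reduced P w -> reduced Q (map_word w).
Proof.
elim: w => //= a w IHw [Pa a1 hw /IHw Qw]; split=> //=.
- by apply: homP; exists (tagged a).
- by move=> /(kerP Pa).
- by rewrite -map_comp.
Qed.

Lemma generated_strong_inj :
  (forall i, set_inj (P i) (phi i)) -> set_inj (free_product_cone f P) psi.
Proof.
move=> injP x y; rewrite !inE.
move=> /(free_product_coneP coneP)[v rv <-].
move=> /(free_product_coneP coneP)[w rw <-].
rewrite !psi_eval => /(uniq_g (reduced_map rv) (reduced_map rw)) vw.
congr word_eval; elim: v w rv rw vw => [|[i x1] v IHv] [|[j y1] w] //=.
move=> [Px _ _ rv] [Py _ _ rw] [ij].
case: j / ij y1 Py => y1 Py xy /(IHv _ rv rw) ->.
congr (Tagged G _ :: _); apply: (injP i); rewrite ?inE //.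
exact: eq_from_Tagged xy.
Qed.

Lemma generated_strong_reduction :
  (forall i, strong_reduction (P i) (Q i) (phi i)) ->
  strong_reduction (free_product_cone f P) (free_product_cone g Q) psi.
Proof.
move=> sphi; split; first exact: generated_order_hom.
split; last first.
(* Surjectivity: the image of the cone is a submonoid containing the generators of the target
   cone. *)
- apply: smallest_sub.
    split=> [|_ _ [x Px <-] [y Py <-]].
      by exists 1; [exact: free_product_cone1 | exact: gmulf1].
    by exists (x * y); [exact: free_product_coneM | exact: gmulfM].
  move=> _ [i _ [y Qy <-]].
  have [_ [_ _ /(_ y Qy) [x Px <-]]] := sphi i.
  by exists (f i x); [exact: free_product_cone_inj | exact: psi_f].
- by apply: generated_strong_inj => i; case: (sphi i) => _ [].
- by move=> x Px; apply: generated_order_hom; exists x.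
Qed.

Let map_word_eq_cons w i (c : H i) w' : map_word w = Tagged H c :: w' ->
  exists (b : G i) w'', w = Tagged G b :: w'' /\ phi i b = c.
Proof.
case: w => [//|[j b] w] [ji]; case: i / ji c => c bc _.
by exists b, w; split=> //; exact: eq_from_Tagged bc.
Qed.

Let reduced_headP i (b : G i) w : reduced P (Tagged G b :: w) ->
  [/\ P i b, b <> 1 & free_product_cone f P (word_eval f w)].
Proof. by case=> Pb b1 _ rw; split=> //; exact: free_product_cone_eval. Qed.

(** Induction on a reduced word for [k]. Its first letter [a] lies below the image of the first
    letter [b0] of [p], so it lifts to some [b] in [[1, b0]]; cancelling [b] from [p] leaves a
    shorter problem. *)
Let interval_lift p k k' : free_product_cone f P p ->
  free_product_cone g Q k -> free_product_cone g Q k' -> k * k' = psi p ->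
  exists x, [/\ free_product_cone f P x, free_product_cone f P (x^-1 * p) &
    psi x = k].
Proof.
move=> Pp /(free_product_coneP coneQ)[u ru <-] Qk'.
elim: u ru p Pp => [|[i a] u IHu] ru p Pp.
  exists 1; rewrite invg1 mul1g word_eval_nil gmulf1.
  by split=> //; exact: free_product_cone1.
case: ru => /= Qa a1 _ ru; rewrite word_eval_cons /= -mulgA => pE.
have Qu := free_product_cone_eval (f := g) ru.
have [w rw wE] := free_product_coneP coneP Pp.
have := pE; rewrite -wE psi_eval.
have Quk' := free_product_coneM Qu Qk'.
case/(first_letter coneQ uniq_g Qa a1 Quk' (reduced_map rw)).
move=> c [w' [/map_word_eq_cons[b0 [w0 [w0E <-]]] ac]]; subst w.
have [Pb0 _ Pw0] := reduced_headP rw.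
have [b [Pb Pbb0 ba]] := reduction_lift (redP i) Pb0 Qa ac.
have [||x [Px Pxp xE]] := IHu ru (f i (b^-1 * b0) * word_eval f w0).
- by apply: free_product_coneM => //; exact: free_product_cone_inj.
- apply: (mulgI (g i a)); rewrite pE -wE word_eval_cons /= -ba.
  by rewrite -psi_f -[psi _ * psi _]gmulfM mulgA -[f i _ * f i _]gmulfM mulVKg.
exists (f i b * x); split.
- by apply: free_product_coneM => //; exact: free_product_cone_inj.
- by rewrite word_eval_cons /= invgM -mulgA -gmulfV (mulgA (f i _)) -gmulfM.
- by rewrite gmulfM psi_f ba xE.
Qed.

(** Induction on a reduced word for [x]. Let [b], [c], [d] be the first letters of [x], [y], [p].
    Comparing images gives [phi i b] below [phi i c], and [b], [c] are both below [d], so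
    [reduction_le] puts [b] below [c] and [b] cancels from all three elements. *)
Let interval_inj p x y :
  free_product_cone f P x -> free_product_cone f P (x^-1 * p) ->
  free_product_cone f P y -> free_product_cone f P (y^-1 * p) ->
  psi x = psi y -> x = y.
Proof.
move=> /(free_product_coneP coneP)[u ru <-].
elim: u ru p y => [|[i b] u IHu] ru p y.
  move=> _ /(free_product_coneP coneP)[w rw <-] _.
  rewrite !psi_eval => uw.
  have := uniq_g (reduced_map ru) (reduced_map rw) uw.
  by case: w {rw uw} => [|? ?].
have [Pb b1 Pu] := reduced_headP ru.
have {}ru : reduced P u by case: ru.
move=> Pup Py Pyp xy.
have Pp : free_product_cone f P p.
  by rewrite -(mulVKg y p); exact: free_product_coneM.
have [w rw wE] := free_product_coneP coneP Pp.
have [v rv vE] := free_product_coneP coneP Py.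
have := xy; rewrite -vE word_eval_cons gmulfM psi_f /= !psi_eval.
have Qb : Q i (phi i b) by apply: homP; exists b.
have phib1 : phi i b <> 1 by move=> /(kerP Pb).
have Qu := free_product_cone_eval (f := g) (reduced_map ru).
case/(first_letter coneQ uniq_g Qb phib1 Qu (reduced_map rv)).
move=> c' [v' [/map_word_eq_cons[c [v0 [v0E <-]]] phibc]]; subst v.
have [Pc c1 Pv0] := reduced_headP rv.
have : f i b * (word_eval f u * ((word_eval f (Tagged G b :: u))^-1 * p)) =
    word_eval f w.
  by rewrite mulgA -(word_eval_cons f (Tagged G b)) mulVKg.
case/(first_letter coneP uniq_f Pb b1 (free_product_coneM Pu Pup) rw).
move=> d [w0 [w0E bd]]; subst w.
have : f i c * (word_eval f v0 * (y^-1 * p)) = word_eval f (Tagged G d :: w0).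
  by rewrite mulgA wE -(word_eval_cons f (Tagged G c)) vE mulVKg.
case/(first_letter coneP uniq_f Pc c1 (free_product_coneM Pv0 Pyp) rw).
move=> d' [w0' [dd' cd]]; have {dd'} dd' : d = d'.
  exact: eq_from_Tagged (congr1 (head (Tagged G d)) dd').
subst d'.
have [Pd _ _] := reduced_headP rw.
have bc := reduction_le (redP i) (coneP i) Pd Pb bd Pc cd phibc.
(* This is [y] with [b] cancelled; it stays in the cone because [b] is below [c]. *)
set y' := f i (b^-1 * c) * word_eval f v0.
have yE : f i b * y' = y.
  by rewrite -vE word_eval_cons /y' mulgA -gmulfM mulVKg.
have uE : f i b * word_eval f u = word_eval f (Tagged G b :: u).
  by rewrite word_eval_cons.
have cancelb z : z^-1 * ((f i b)^-1 * p) = (f i b * z)^-1 * p.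
  by rewrite invgM mulgA.
rewrite vE -yE; congr (_ * _); apply: (IHu ru ((f i b)^-1 * p)).
- by rewrite cancelb uE.
- by apply: free_product_coneM => //; exact: free_product_cone_inj.
- by rewrite cancelb yE.
- by apply: (mulgI (psi (f i b))); rewrite -!gmulfM uE yE.
Qed.

Lemma generated_reduction : 
  reduction (free_product_cone f P) (free_product_cone g Q) psi.
Proof.
apply: reductionP => [|p k Pp Qk Qk'|p x y _].
- exact: generated_order_hom.
- by apply: (interval_lift Pp Qk Qk'); exact: mulVKg.
- exact: interval_inj.
Qed.
End GeneratedReduction.

(** * The free product of positive cones in a lamplighter group *)

Section Embedding.
Variables (I : finType) (G : I -> groupType) (P : forall i, set (G i)).
Arguments P : clear implicits.
Hypothesis coneP : forall i, positive_cone (P i).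
Let D := direct_product G.

Definition single i (x : G i) : D := dfwith (fun=> 1) i x.

Let singleM i (x y : G i) : single (x * y) = single x * single y.
Proof.
apply: functional_extensionality_dep => j; rewrite direct_productM /single.
have [<-|ij] := eqVneq i j; first by rewrite !dfwithin.
by rewrite !dfwithout// mulg1.
Qed.

Let single1 i : single (1 : G i) = 1.
Proof.
apply: functional_extensionality_dep => j; rewrite /single.
have [<-|ij] := eqVneq i j; first by rewrite dfwithin.
by rewrite dfwithout.
Qed.

(* The conjugate of [(1, single x)] by the lamp at [(i, 1)]. *)
Definition lamp_path i (x : G i) : lamplighter I D :=
  ((fun j y => (j == i) && ((y == 1) (+) (y == single x))) : lamps I D,
   single x).

(** Paths concatenate: the lamp at [single x] is toggled by both [x] and the shifted path of [y],
    and goes out. *)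
Let lamp_path_morphism i : monoid.monoid_morphism (@lamp_path i).
Proof.
split=> [|x y]; rewrite /lamp_path.
  rewrite single1; congr pair; apply/funext => j; apply/funext => y.
  by rewrite addbb andbF.
rewrite lamplighterM /= singleM; congr pair.
apply/funext => j; apply/funext => z.
rewrite lampsM /shift; have [_|//] := eqVneq j i.
have -> : ((single x)^-1 * z == 1) = (z == single x).
  by rewrite -(inj_eq (mulgI (single x))) mulVKg mulg1.
have -> : ((single x)^-1 * z == single y) = (z == single x * single y).
  by rewrite -(inj_eq (mulgI (single x))) mulVKg.
by rewrite /= -addbA addKb.
Qed.

HB.instance Definition _ i :=
  isUMagmaMorphism.Build (G i) (lamplighter I D) (@lamp_path i)
    (lamp_path_morphism i).

Let path_hom i : group_hom (G i) (lamplighter I D) := @lamp_path i.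
Let lit w := (word_eval path_hom w).1.

Let lit_nil j y : lit [::] j y = false.
Proof. by rewrite /lit word_eval_nil. Qed.

Let lit_cons i (x : G i) w j y : lit (Tagged G x :: w) j y =
  (j == i) && ((y == 1) (+) (y == single x)) (+) lit w j ((single x)^-1 * y).
Proof. by rewrite /lit word_eval_cons. Qed.

Let cone_single i (x : G i) : P i x -> direct_product_cone P (single x).
Proof.
move=> Px j; rewrite /single; have [<-|ij] := eqVneq i j.
  by rewrite dfwithin.
by rewrite dfwithout//; exact: cone1.
Qed.

Let single_eq1 i (x : G i) : single x = 1 -> x = 1.
Proof. by move=> /(congr1 (fun d : D => d i)); rewrite /single dfwithin. Qed.

Let lit_cone w j y : reduced P w -> lit w j y -> direct_product_cone P y.
Proof.
elim: w y => [|[i x] w IHw] y; first by rewrite lit_nil.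
case=> /= Px _ _ rw; rewrite lit_cons.
have [->|_] := eqVneq y 1; first by move=> _ k; exact: cone1.
have [->|_] := eqVneq y (single x); first by move=> _; exact: cone_single.
rewrite andbF => /(IHw _ rw) Py; rewrite -(mulVKg (single x) y) => k.
by apply: coneM; [exact: coneP | exact: cone_single | exact: Py].
Qed.

(** The tail lights only lamps shifted by [x] from the cone; one of them at [1] would make [x^-1]
    positive. *)
Let lit_at1 i (x : G i) w j : reduced P (Tagged G x :: w) ->
  lit (Tagged G x :: w) j 1 = (j == i).
Proof.
case=> /= Px x1 _ rw; rewrite lit_cons mulg1 eqxx.
have -> : (1 == single x) = false.
  by apply/eqP => /esym/single_eq1.
rewrite addbF andbT; have [/(lit_cone rw)/(_ i) Pxi|] := boolP (lit _ _ _).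
  case: x1; apply: (cone_eq1 (coneP i) Px Pxi).
  by rewrite direct_productV /single dfwithin mulgV.
by rewrite addbF.
Qed.

(** Only the lamp at [1] of the tail could extinguish this one, and it belongs to the factor of the
    second letter, which is not [i]. *)
Let lit_at_letter i (x : G i) w : reduced P (Tagged G x :: w) ->
  lit (Tagged G x :: w) i (single x).
Proof.
case=> /= Px x1 hw rw; rewrite lit_cons !eqxx mulVg.
have -> : (single x == 1) = false by apply/eqP => /single_eq1.
case: w hw rw => [|[j y] w] hw rw; first by rewrite lit_nil.
rewrite lit_at1 //=; have [ij|//] := eqVneq i j.
by case: hw; rewrite /= ij.
Qed.

Let lit_after_letter i (x : G i) w j y : reduced P (Tagged G x :: w) ->
  lit (Tagged G x :: w) j y -> y = 1 \/ cone_le (P i) x (y i).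
Proof.
case=> /= Px _ _ rw; rewrite lit_cons.
have [->|_] := eqVneq y 1; first by left.
have [->|_] := eqVneq y (single x).
  by right; rewrite /single dfwithin /cone_le mulVg; exact: cone1.
rewrite andbF => /(lit_cone rw)/(_ i).
by rewrite direct_productM direct_productV /single dfwithin; right.
Qed.

(** The lamp at [1] gives the factor. Each first letter marks a lit lamp of the other word, hence
    bounds the other first letter from above; antisymmetry concludes. *)
Let ohead_inj v w : reduced P v -> reduced P w -> lit v = lit w ->
  ohead v = ohead w.
Proof.
case: v w => [|[i x] v] [|[j y] w] rv rw // vw.
- by have := lit_at1 j rw; rewrite -vw lit_nil eqxx.
- by have := lit_at1 i rv; rewrite vw lit_nil eqxx.
have ij : i = j.
  apply/eqP; rewrite -(lit_at1 i rw) -[_ :: w]/(Tagged G y :: w) -vw.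
  by rewrite lit_at1 ?eqxx.
case: j / ij y rw vw => y rw vw; congr (Some (Tagged G _)).
have [[_ x1 _ _] [_ y1 _ _]] := (rv, rw).
apply: (cone_le_anti (coneP i)).
- have := lit_at_letter rw; rewrite -[_ :: w]/(existT _ i y :: w) -vw.
  case/(lit_after_letter rv) => [/single_eq1//|].
  by rewrite /single dfwithin.
- have := lit_at_letter rv; rewrite -[_ :: v]/(existT _ i x :: v) vw.
  case/(lit_after_letter rw) => [/single_eq1//|].
  by rewrite /single dfwithin.
Qed.

Lemma lamp_path_unique : unique_reduced P path_hom.
Proof.
elim=> [|a v IHv] w rv rw vw.
  have := ohead_inj rv rw (congr1 fst vw).
  by case: w {rw vw}.
have := ohead_inj rv rw (congr1 fst vw).
case: w rw vw => [//|b w] rw + [ab]; case: b / ab rw => rw.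
rewrite !word_eval_cons => /mulgI vw; congr (_ :: _).
by apply: IHv => //; [case: rv | case: rw].
Qed.

End Embedding.

(** The universal property maps [F] to the lamplighter group over the [G i] themselves, where
    uniqueness is known. *)
Lemma free_product_unique_reduced (I : finType) (G : I -> groupType)
    (P : forall i, set (G i)) (F : groupType)
    (iota : forall i, group_hom (G i) F) :
  is_free_product iota -> (forall i, positive_cone (P i)) ->
  unique_reduced P iota.
Proof.
move=> freeF coneP.
have [h [hE _]] := freeF _ (fun i => @lamp_path I G i : group_hom _ _).
exact: unique_reduced_comp hE (lamp_path_unique coneP).
Qed.

Lemma free_product_reduction (R : realType) (I : finType)
    (G H : I -> groupType) (P : forall i, set (G i)) (Q : forall i, set (H i))
    (phi : forall i, group_hom (G i) (H i)) (F : groupType)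
    (iota : forall i, group_hom (G i) F) :
  is_free_product iota -> (forall i, positive_cone (P i)) ->
  (forall i, amenable R (H i)) -> (forall i, positive_cone (Q i)) ->
  (forall i, reduction (P i) (Q i) (phi i)) ->
  exists (K : groupType) (T : set K) (psi : group_hom F K),
    [/\ amenable R K, positive_cone T,
      reduction (free_product_cone iota P) T psi
    & (forall i, strong_reduction (P i) (Q i) (phi i)) ->
      strong_reduction (free_product_cone iota P) T psi].
Proof.
move=> freeF coneP amH coneQ redP.
have uniqF := free_product_unique_reduced freeF coneP.
have uniqL := lamp_path_unique coneQ.
pose path i : group_hom (H i) (lamplighter I (direct_product H)) :=
  @lamp_path I H i.
have [psi [psiE _]] := freeF _ (fun i => path i \o phi i : group_hom _ _).
exists (lamplighter I (direct_product H)), (free_product_cone path Q), psi.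
split.
- by apply: lamplighter_amenable; exact: direct_product_amenable.
- exact: free_product_cone_positive.
- exact: (generated_reduction coneP coneQ psiE uniqF uniqL redP).
- exact: (generated_strong_reduction coneP psiE uniqL redP).
Qed.

(** Any order homomorphism injective on the cone becomes a strong reduction once the target cone is
    cut down to the image. *)
Lemma strong_reduction_image (G H : groupType) (P : set G) (Q : set H)
    (phi : group_hom G H) :
  positive_cone P -> positive_cone Q -> order_hom P Q phi -> set_inj P phi ->
  positive_cone (phi @` P) /\ strong_reduction P (phi @` P) phi.
Proof.
move=> coneP coneQ homP injP; split; last first.
  by split=> //; split=> // x Px; exists x.
apply: positive_coneP; first split.
- by exists 1; [exact: cone1 | exact: gmulf1].
- move=> _ _ [x Px <-] [y Py <-].
  by exists (x * y); [exact: coneM | exact: gmulfM].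
- by move=> x y Px Py; apply: (cone_eq1 coneQ); exact: homP.
Qed.

(** * Restriction of reductions to hereditary subgroups *)

Section HereditarySubgroup.
Variables (G H : groupType) (P : set G) (S : pred G) (K : subGroupType S).
Variables (Q : set K) (T : set H) (phi : group_hom G H).
Hypothesis hQP : hereditary_subgroup P Q.

Lemma hereditary_val x : Q x -> P (val x).
Proof. by move=> Qx; case: hQP => _ [_ + _]; apply; exists x. Qed.

(** Heredity applied to [x * (x^-1 * val q)] puts both factors in [Q], so below an element of [Q]
    the intervals of [P] and [Q] coincide. *)
Let val_cone_interval q x : Q q ->
  P x -> P (x^-1 * val q) -> exists2 y, cone_interval Q q y & val y = x.
Proof.
move=> Qq Px Pxq; case: (hQP) => coneQ [_ _ /(_ _ _ Px Pxq)].
rewrite mulVKg => /(_ (ex_intro2 _ _ q Qq erefl))[[y Qy yx] [z Qz zE]].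
exists y => //; apply/cone_intervalE; split=> //.
suff -> : y^-1 * q = z by [].
by apply: val_inj; rewrite zE -yx gmulfM gmulfV.
Qed.

Let valPV q x : Q (x^-1 * q) -> P ((val x)^-1 * val q).
Proof. by move=> /hereditary_val; rewrite gmulfM gmulfV. Qed.

Lemma hereditary_order_hom : order_hom P T phi -> order_hom Q T (phi \o val).
Proof.
by move=> homP _ [x /hereditary_val Px <-]; apply: homP; exists (val x).
Qed.

Lemma hereditary_reduction : reduction P T phi -> reduction Q T (phi \o val).
Proof.
move=> redP; apply: reductionP.
- by apply: hereditary_order_hom; case: redP.
- move=> q a Qq Ta Taq.
  have [x [Px Pxq <-]] := reduction_lift redP (hereditary_val Qq) Ta Taq.
  have [y /cone_intervalE[Qy Qyq] <-] := val_cone_interval Qq Px Pxq.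
  by exists y.
- move=> q x y Qq Qx Qxq Qy Qyq xy; apply: val_inj.
  exact: (reduction_inj redP (hereditary_val Qq) (hereditary_val Qx)
    (valPV Qxq) (hereditary_val Qy) (valPV Qyq) xy).
Qed.

End HereditarySubgroup.

(** * Coordinatewise reductions of direct products *)

Section ProductReduction.
Variables (I : finType) (G H : I -> groupType).
Variables (P : forall i, set (G i)) (Q : forall i, set (H i)).
Variable phi : forall i, group_hom (G i) (H i).
Arguments P : clear implicits.
Arguments Q : clear implicits.

Definition product_map (x : direct_product G) : direct_product H :=
  fun i => phi i (x i).

Let product_map_morphism : monoid.monoid_morphism product_map.
Proof.
by split=> [|x y]; apply: functional_extensionality_dep => i;
  [exact: gmulf1 | exact: gmulfM].
Qed.

HB.instance Definition _ :=
  isUMagmaMorphism.Build (direct_product G) (direct_product H) product_map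
    product_map_morphism.

Lemma direct_product_cone_positive : (forall i, positive_cone (P i)) ->
  positive_cone (direct_product_cone P).
Proof.
move=> coneP; apply: positive_coneP; first split.
- by move=> i; exact: cone1.
- by move=> x y Px Py i; apply: coneM.
- move=> x y Px Py xy; apply: functional_extensionality_dep => i.
  exact: (cone_eq1 (coneP i) (Px i) (Py i) (congr1 (fun d => d i) xy)).
Qed.

Lemma product_map_reduction : (forall i, reduction (P i) (Q i) (phi i)) ->
  reduction (direct_product_cone P) (direct_product_cone Q) product_map.
Proof.
move=> redP; apply: reductionP.
- move=> _ [x Px <-] i; have [homP _] := redP i.
  by apply: homP; exists (x i).
- move=> p a Pp Qa Qap.
  pose lift i := reduction_lift (redP i) (Pp i) (Qa i) (Qap i).
  exists (fun i => sval (cid (lift i))); split=> [i|i|].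
  + by have [] := svalP (cid (lift i)).
  + by rewrite direct_productM direct_productV; have [] := svalP (cid (lift i)).
  + apply: functional_extensionality_dep => i; rewrite /product_map.
    by have [] := svalP (cid (lift i)).
- move=> p x y Pp Px Pxp Py Pyp xy; apply: functional_extensionality_dep => i.
  exact: (reduction_inj (redP i) (Pp i) (Px i) (Pxp i) (Py i) (Pyp i)
    (congr1 (fun d => d i) xy)).
Qed.

Lemma product_map_strong : (forall i, strong_reduction (P i) (Q i) (phi i)) ->
  strong_reduction (direct_product_cone P) (direct_product_cone Q) product_map.
Proof.
move=> redP.
have homP :
    order_hom (direct_product_cone P) (direct_product_cone Q) product_map.
  move=> _ [x Px <-] i; have [homP _] := redP i.
  by apply: homP; exists (x i).
split=> //; split.
- by move=> x Px; apply: homP; exists x.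
- move=> x y; rewrite !inE => Px Py xy.
  apply: functional_extensionality_dep => i.
  have [_ [_ inj _]] := redP i.
  apply: inj; rewrite ?inE; [exact: Px | exact: Py |].
  exact: (congr1 (fun d => d i) xy).
- move=> y Qy; have lift i : exists x, P i x /\ phi i x = y i.
    by have [_ [_ _ /(_ _ (Qy i))[x Px xy]]] := redP i; exists x.
  exists (fun i => sval (cid (lift i))) => [i|].
    by have [] := svalP (cid (lift i)).
  apply: functional_extensionality_dep => i; rewrite /product_map.
  by have [] := svalP (cid (lift i)).
Qed.

End ProductReduction.

(** Groups, cones and homomorphisms are chosen in turn, since the type of each depends on the
    previous choice. *)
Lemma family_choice (I : Type) (G : I -> groupType)
    (A : forall i (H : groupType), set H -> group_hom (G i) H -> Prop) :
  (forall i, exists (H : groupType) (Q : set H) (phi : group_hom (G i) H),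
    A i H Q phi) ->
  exists (H : I -> groupType) (Q : forall i, set (H i))
    (phi : forall i, group_hom (G i) (H i)), forall i, A i (H i) (Q i) (phi i).
Proof.
move=> ex; pose H i := cid (ex i); pose Q i := cid (svalP (H i)).
pose phi i := cid (svalP (Q i)).
exists (fun i => sval (H i)), (fun i => sval (Q i)).
exists (fun i => sval (phi i)) => i.
exact: svalP (phi i).
Qed.

Theorem theorem3p30 (R : realType) :
  [/\ forall (G : groupType) (P : set G),
        positive_cone P -> amenable R G -> has_amenable_reduction R P,
      closed_hereditary_subgroups (@has_amenable_reduction R),
      closed_finite_direct_products (@has_amenable_reduction R)
    & closed_finite_free_products (@has_amenable_reduction R)] /\
  [/\ forall (G : groupType) (P : set G),
        positive_cone P -> amenable R G -> has_amenable_strong_reduction R P,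
      closed_hereditary_subgroups (@has_amenable_strong_reduction R),
      closed_finite_direct_products (@has_amenable_strong_reduction R)
    & closed_finite_free_products (@has_amenable_strong_reduction R)].
Proof.
split; split.
- move=> G P coneP amG; split=> //.
  exists G, P, (idfun : group_hom G G); split=> //.
  by apply: reductionP => [_ [x Px <-] //|p a Pp Pa Pap|//]; exists a.
- move=> G P S K Q [_ [H [T [phi [amH coneT redP]]]]] hQP.
  split; first by case: hQP.
  exists H, T, (phi \o val : group_hom K H); split=> //.
  exact: hereditary_reduction hQP redP.
- move=> I G P redP.
  have [H [Q [phi hphi]]] := family_choice (fun i => (redP i).2).
  split; first by apply: direct_product_cone_positive => i; case: (redP i).
  exists (direct_product H), (direct_product_cone Q).
  exists (product_map phi : group_hom _ _); split.
  + by apply: direct_product_amenable => i; case: (hphi i).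
  + by apply: direct_product_cone_positive => i; case: (hphi i).
  + by apply: product_map_reduction => i; case: (hphi i).
- move=> I G P F iota freeF redP.
  have coneP i : positive_cone (P i) by case: (redP i).
  have [H [Q [phi hphi]]] := family_choice (fun i => (redP i).2).
  have amH i : amenable R (H i) by case: (hphi i).
  have coneQ i : positive_cone (Q i) by case: (hphi i).
  split.
    exact: free_product_cone_positive (free_product_unique_reduced freeF coneP).
  have [|K [T [psi [amK coneT redF _]]]] :=
    free_product_reduction (phi := phi) freeF coneP amH coneQ.
    by move=> i; case: (hphi i).
  by exists K, T, psi.
- move=> G P coneP amG; split=> //.
  exists G, P, (idfun : group_hom G G); split=> //.
  by split=> [_ [x Px <-] //|]; split=> // x Px; exists x.
- move=> G P S K Q [_ [H [T [phi [amH coneT [homP [_ injP _]]]]]]] hQP.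
  have coneQ : positive_cone Q by case: hQP.
  split=> //; have homQ := hereditary_order_hom hQP homP.
  (* The restricted map need not be onto [T], so [T] is replaced by the image of [Q]. *)
  have [|coneT' strongQ] := strong_reduction_image
      (phi := phi \o val : group_hom K H) coneQ coneT homQ.
    move=> x y; rewrite !inE => Qx Qy xy; apply: val_inj; move: xy.
    by apply: injP; rewrite inE; exact: (hereditary_val hQP).
  by exists H, ((phi \o val) @` Q), (phi \o val : group_hom K H).
- move=> I G P redP.
  have [H [Q [phi hphi]]] := family_choice (fun i => (redP i).2).
  split; first by apply: direct_product_cone_positive => i; case: (redP i).
  exists (direct_product H), (direct_product_cone Q).
  exists (product_map phi : group_hom _ _); split.
  + by apply: direct_product_amenable => i; case: (hphi i).
  + by apply: direct_product_cone_positive => i; case: (hphi i).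
  + by apply: product_map_strong => i; case: (hphi i).
- move=> I G P F iota freeF redP.
  have coneP i : positive_cone (P i) by case: (redP i).
  have [H [Q [phi hphi]]] := family_choice (fun i => (redP i).2).
  have amH i : amenable R (H i) by case: (hphi i).
  have coneQ i : positive_cone (Q i) by case: (hphi i).
  split.
    exact: free_product_cone_positive (free_product_unique_reduced freeF coneP).
  have [|K [T [psi [amK coneT _ strongF]]]] :=
    free_product_reduction (phi := phi) freeF coneP amH coneQ.
    by move=> i; apply: strong_reductionW => //; case: (hphi i).
  by exists K, T, psi; split=> //; apply: strongF => i; case: (hphi i).
Qed.
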